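(* Let $(M_n)_{n\in\mathbb{N}_0}$ be a log-convex sequence of positive real numbers. If $$\sum_{n=1}^\infty\frac{1}{\sqrt[2n]{M_{2n}}}=\infty,$$ then for every $h\in\mathbb{N}_0$ $$\sum_{n=1}^\infty\frac{1}{\sqrt[2n]{M_{2n+h}}}=\infty.$$
   Context: $\mathbb{N}_0$ is the set of non-negative integers. A sequence $(M_n)_{n\in\mathbb{N}_0}$ of positive reals is log-convex if $M_n^2\le M_{n-1}M_{n+1}$ for all $n\ge1$. *)

(* Defs.v *)
From HB Require Import structures.
From mathcomp Require Import all_boot all_order all_algebra.
From mathcomp Require Import all_classical all_reals all_analysis.

Set Implicit Arguments.
Unset Strict Implicit.
Unset Printing Implicit Defensive.

Import Order.TTheory GRing.Theory Num.Theory.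

Local Open Scope ring_scope.

Definition log_convex (R : realType) (M : nat -> R) : Prop :=
  forall n : nat, (1 <= n)%N -> M n ^+ 2 <= M n.-1 * M n.+1.

(* Only meant for k > 0 and x > 0, where x `^ k^-1 is the positive k-th root. *)
Definition nth_root (R : realType) (k : nat) (x : R) : R := x `^ (k%:R)^-1.

(* Main.v *)
(** Put x = ln M, a convex sequence, and B = max (x 0) 0.  Then (x k - B) / k
    is nondecreasing in k >= 1.  Let s be its value at k = 2n + h.  On one hand
    s <= x (2(n + h)) / (2(n + h)).  On the other hand
    x (2n + h) / 2n = s + (s h + B) / 2n, which is at most s + h + B as long as
    s <= n, while expR (- s) <= 2^-n otherwise.  In both cases
      M_{2(n+h)}^{-1/(2(n+h))} <= e^{h+B} M_{2n+h}^{-1/2n} + 2^-n,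
    so the shifted divergent series is dominated by a multiple of the target
    series plus a convergent one. *)
Require Import Defs.
From HB Require Import structures.
From mathcomp Require Import all_boot all_order all_algebra.
From mathcomp Require Import all_classical all_reals all_analysis.
From mathcomp Require Import ring lra.

Set Implicit Arguments.
Unset Strict Implicit.
Unset Printing Implicit Defensive.

Import Order.TTheory GRing.Theory Num.Theory.

Local Open Scope ring_scope.

(** Dropping finitely many terms keeps the sum of [a] infinite, and this tail is at most [c] times
    the sum of [t] plus 1. *)
Lemma nneseries_pinfty_shift_le (R : realType) (a t : nat -> R) (h : nat)
    (c : R) :
  (forall n, 0 <= a n) -> (forall n, 0 <= t n) -> 0 <= c ->
  (forall n, (0 < n)%N -> a (n + h)%N <= c * t n + 1 / (2 ^ n)%:R) ->
  (\sum_(1 <= n <oo) (a n)%:E = +oo)%E -> (\sum_(1 <= n <oo) (t n)%:E = +oo)%E.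
Proof.
move=> a0 t0 c0 le_at sum_a.
have tail_a : (\sum_(1 + h <= n <oo) (a n)%:E = +oo)%E.
  move: sum_a; rewrite (nneseries_split 1 h) => [|k _]; last by rewrite lee_fin.
  by rewrite sumEFin; case: (limn _).
have sum_t0 : (0 <= \sum_(1 <= n <oo) (t n)%:E)%E.
  by apply: nneseries_ge0 => n _ _; rewrite lee_fin.
have : (+oo <= c%:E * \sum_(1 <= n <oo) (t n)%:E + 1%:E)%E.
  rewrite -[leLHS]tail_a -[leLHS]nneseries_addn => [|i]; last by rewrite lee_fin.
  rewrite -[in leRHS]nneseries_addn => [|i]; last by rewrite lee_fin.
  rewrite -nneseriesZl => [|i _]; last by rewrite lee_fin.
  have ct0 i : (0 <= c%:E * (t (i + 1)%N)%:E)%E by rewrite -EFinM lee_fin mulr_ge0.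
  (* With [n = i + 1], the errors [2^-n] are those of the epsilon trick for epsilon 1. *)
  apply: le_trans (epsilon_trick xpredT ct0 ler01).
  apply: lee_nneseries => [i _ _|i _]; first by rewrite lee_fin.
  rewrite -EFinM -EFinD lee_fin addnA !addn1.
  exact: le_at.
by move: sum_t0; case: (limn _).
Qed.

Section ConvexSequence.
Context {R : realType} (y : nat -> R).
Hypothesis y_convex : forall n, y n.+1 *+ 2 <= y n + y n.+2.
Hypothesis y0_le0 : y 0%N <= 0.

(** Increments are nondecreasing, so each of the first [n] is at most the next one, and
    [y 0 <= 0]. *)
Lemma convex_seq_le_step n : y n <= n%:R * (y n.+1 - y n).
Proof.
elim: n => [|n IH]; first by rewrite mul0r.
have n1_ge0 : 0 <= n.+1%:R :> R by [].
have := ler_wpM2l n1_ge0 (y_convex n).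
rewrite -natr1; lra.
Qed.

(** For consecutive indices, clearing denominators gives exactly [convex_seq_le_step]. *)
Lemma convex_seq_ratio_homo m n : (0 < m)%N -> (m <= n)%N ->
  y m / m%:R <= y n / n%:R.
Proof.
move=> m_gt0; elim: n => [|n IH]; first by rewrite leqn0 => /eqP->.
rewrite leq_eqVlt => /predU1P[->//|]; rewrite ltnS => le_mn.
apply: le_trans (IH le_mn) _.
have n_gt0 : (0 < n)%N by apply: leq_trans le_mn.
rewrite ler_pdivrMr ?ltr0n// mulrAC ler_pdivlMr ?ltr0n//.
have := convex_seq_le_step n; rewrite -natr1; lra.
Qed.

End ConvexSequence.

Lemma inv_nth_root (R : realType) (k : nat) (z : R) : 0 < z ->
  1 / nth_root k z = expR (- (ln z / k%:R)).
Proof.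
by move=> z0; rewrite /nth_root /powR gt_eqF// div1r expRN mulrC.
Qed.

Lemma expRN_nat_le_half_pow (R : realType) (n : nat) :
  expR (- n%:R) <= 1 / (2 ^ n)%:R :> R.
Proof.
rewrite expRN div1r lef_pV2 ?posrE ?expR_gt0 ?ltr0n ?expn_gt0//.
rewrite natrX -[n%:R]mulr1 expRM_natl lerXn2r ?nnegrE ?expR_ge0//.
(* The tangent bound at 0 gives [e >= 2]. *)
by have := expR_ge1Dx (1 : R); lra.
Qed.

Theorem theorem4p6 (R : realType) (M : nat -> R)
  (M_gt0 : forall n : nat, 0 < M n)
  (M_log_convex : log_convex M)
  (M_div : (\sum_(1 <= n <oo) (1 / nth_root (2 * n) (M (2 * n)%N))%:E = +oo)%E) :
  forall h : nat,
    (\sum_(1 <= n <oo) (1 / nth_root (2 * n) (M (2 * n + h)%N))%:E = +oo)%E.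
Proof.
move=> h.
pose x n := ln (M n); pose B := Num.max (x 0%N) 0; pose y n := x n - B.
have B_ge0 : 0 <= B by rewrite le_max lexx orbT.
have y0_le0 : y 0%N <= 0 by rewrite subr_le0 le_max lexx.
have y_convex n : y n.+1 *+ 2 <= y n + y n.+2.
  have : x n.+1 *+ 2 <= x n + x n.+2.
    rewrite -lnXn// -lnM ?posrE// ler_ln ?posrE ?exprn_gt0 ?mulr_gt0//.
    exact: M_log_convex.
  rewrite /y; lra.
apply: (nneseries_pinfty_shift_le (h := h) (c := expR (h%:R + B))) M_div.
- by move=> n; rewrite inv_nth_root// expR_ge0.
- by move=> n; rewrite inv_nth_root// expR_ge0.
- exact: expR_ge0.
move=> n n_gt0; rewrite !inv_nth_root// -expRD -/(x _) -/(x _).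
have nR_ge1 : 1 <= n%:R :> R by rewrite ler1n.
have hR_ge0 : 0 <= h%:R :> R by [].
set s := y (2 * n + h)%N / (2 * n + h)%:R.
have s_le : s <= x (2 * (n + h))%N / (2 * (n + h))%:R.
  (* Ratios of [y] are compared at [2n + h <= 2(n + h)]; then [y <= x] because [B >= 0]. *)
  apply: le_trans (convex_seq_ratio_homo y_convex y0_le0 (n := 2 * (n + h)) _ _) _.
  - by rewrite addn_gt0 muln_gt0 n_gt0.
  - by rewrite mulnDr leq_add2l leq_pmull.
  by rewrite ler_wpM2r ?invr_ge0// gerBl.
have {s_le} : expR (- (x (2 * (n + h))%N / (2 * (n + h))%:R)) <= expR (- s).
  by rewrite ler_expR lerN2.
move=> /le_trans; apply.
have [s_le_n|n_lt_s] := leP s n%:R; last first.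
  rewrite -[leLHS]add0r lerD ?expR_ge0//.
  apply: le_trans (expRN_nat_le_half_pow R n).
  by rewrite ler_expR lerN2 ltW.
rewrite -[leLHS]addr0 lerD ?divr_ge0// ler_expR.
suff : x (2 * n + h)%N / (2 * n)%:R <= s + h%:R + B by lra.
have -> : x (2 * n + h)%N = s * (2 * n + h)%:R + B.
  by rewrite /s divfK ?subrK// pnatr_eq0 -lt0n addn_gt0 muln_gt0 n_gt0.
rewrite ler_pdivrMr ?ltr0n ?muln_gt0// natrD natrM.
(* After cancelling [2ns], it remains to show [sh + B <= 2n(h + B)], from [s <= n] and [n >= 1]. *)
have : s * h%:R <= n%:R * h%:R by rewrite ler_wpM2r.
have : B <= n%:R * B by rewrite ler_peMl.
have : 0 <= n%:R * h%:R :> R by rewrite mulr_ge0.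
lra.
Qed.
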